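(* Fix deterministic $p\ge1$ and $\tau\lesssim N^{-4/3}$. For $t\ge0$ let $\mathfrak p^{\mathbb L}_t$ be the probability density, with respect to $\mathbb P^{\sigma,\mathbb L}$, of the law of $\eta^{\mathbb L}_t$, where the process $\eta^{\mathbb L}$ has initial distribution $\mathbb P^{\sigma,\mathbb L}$ (so $\mathfrak p^{\mathbb L}_0\equiv1$). Then $$\mathbb E^{\sigma,\mathbb L}|\mathfrak p^{\mathbb L}_t|^p\lesssim_p1\qquad\text{uniformly over }t\in[0,\tau].$$
   Context: $a\lesssim b$ means $|a|\le Cb$ with $C$ independent of $N$; in $\lesssim_p$ the constant may also depend on $p$. $\mathbb T_N=\mathbb Z/N\mathbb Z$. The sub-interval $\mathbb L=y+\{-\ell,\dots,\ell\}\subseteq\mathbb T_N$ has length $2\ell+1$ with $\ell=N^\upsilon$, $0<\upsilon\le1/3+\beta$ for a small fixed $\beta>0$, and is treated as a torus with its own periodic boundary conditions ($y+\ell+1=y-\ell$); additions involving points of $\mathbb L$ are taken on this torus. Let $\mathfrak d$ be a fixed uniformly bounded local function of spin configurations ($\mathfrak d[\eta]$ depends only on $\eta_x$ for $x$ in a neighborhood of $0$ of size independent of $N$). Let $(\tau_x\eta)_z=\eta_{x+z}$, and $\mathscr L_x\mathfrak f[\eta]=\mathfrak f[\eta^{x,x+1}]-\mathfrak f[\eta]$, where $\eta^{x,x+1}$ is $\eta$ with $\eta_x,\eta_{x+1}$ swapped. The process $t\mapsto\eta^{\mathbb L}_t\in\{\pm1\}^{\mathbb L}$ is the Markov process with generator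 $$\mathscr L^{\mathbb L}_N=\tfrac12N^2\sum_{x\in\mathbb L}\mathscr L_x+\tfrac12N^{3/2}\sum_{x\in\mathbb L}\big(\mathbf 1_{\eta_x=-1,\eta_{x+1}=1}-\mathbf 1_{\eta_x=1,\eta_{x+1}=-1}\big)\big(1+N^{-1/2}\mathfrak d[\tau_x\eta]\big)\mathscr L_x .$$ For $\sigma\in[-1,1]$ (for which the set is non-empty), $\mathbb P^{\sigma,\mathbb L}$ is the uniform measure on $\{\eta\in\{\pm1\}^{\mathbb L}:|\mathbb L|^{-1}\sum_{x\in\mathbb L}\eta_x=\sigma\}$ and $\mathbb E^{\sigma,\mathbb L}$ its expectation. *)

(* Defs.v *)
From HB Require Import structures.
From mathcomp Require Import all_boot all_order all_algebra.
From mathcomp Require Import perm.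
From mathcomp Require Import all_classical all_reals all_analysis.

Set Implicit Arguments.
Unset Strict Implicit.
Unset Printing Implicit Defensive.

Import Order.TTheory GRing.Theory Num.Theory.
Import numFieldNormedType.Exports.

Local Open Scope classical_set_scope.
Local Open Scope ring_scope.

Definition lesssim (R : realType) (a b : nat -> R) : Prop :=
  exists C : R, forall N : nat, (0 < N)%N -> `|a N| <= C * b N.

(** Continuous-time Markov processes on a finite state space. *)

Section Markov.
Context (R : realType) (E : finType).

Record markov_semigroup (Q : R -> E -> E -> R) : Prop := {
  semigroup_ge0 : forall t x y, 0 <= t -> 0 <= Q t x y;
  semigroup_sum1 : forall t x, 0 <= t -> \sum_y Q t x y = 1;
  semigroup_0 : forall x y, Q 0 x y = (x == y)%:R;
  semigroupD : forall s t x y, 0 <= s -> 0 <= t ->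
    Q (s + t) x y = \sum_z Q s x z * Q t z y }.

Definition semigroup_act (Q : R -> E -> E -> R) (t : R) (f : E -> R) (x : E)
  : R := \sum_y Q t x y * f y.

Definition has_generator (Q : R -> E -> E -> R)
    (L : (E -> R) -> E -> R) : Prop :=
  forall (f : E -> R) (x : E),
    t^-1 * (semigroup_act Q t f x - f x) @[t --> 0^'+] --> L f x.

Context (d : measure_display) (Omega : measurableType d).
Implicit Types (P : probability Omega R) (X : R -> Omega -> E).

(* The event [X_(s 0) = x 0, ..., X_(s n) = x n] generates, as x varies, the
   past of X along the times s 0 <= ... <= s n. *)
Definition markov_property P X (Q : R -> E -> E -> R) : Prop :=
  forall (n : nat) (s : nat -> R) (x : nat -> E) (t : R) (y : E),
    0 <= s 0%N -> (forall i, (i < n)%N -> s i <= s i.+1) -> s n <= t ->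
    let past := \bigcap_(i < n.+1) (X (s i) @^-1` [set x i]) in
    P (past `&` X t @^-1` [set y]) = (P past * (Q (t - s n) (x n) y)%:E)%E.

Definition markov_process P X (L : (E -> R) -> E -> R) : Prop :=
  (forall (t : R) (A : set E), 0 <= t -> measurable (X t @^-1` A)) /\
  exists Q : R -> E -> E -> R,
    [/\ markov_semigroup Q, has_generator Q L & markov_property P X Q].

Definition law P X (t : R) (x : E) : R := fine (P (X t @^-1` [set x])).

End Markov.

(** The sub-interval [y + {-l, ..., l}] of [Z/NZ], as a torus of its own.
    These definitions are only meaningful when [1 <= l] and [2 l + 1 <= N]. *)

Section Torus.
Context (N : nat) (y : 'Z_N) (l : nat).

Definition subinterval : {set 'Z_N} :=
  [set y + (i%:R - l%:R) | i : 'I_(l.*2.+1)]%SET.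

Definition site := {x : 'Z_N | x \in subinterval}.

(* The [i] in {0, ..., 2 l} such that [x = y + (i - l)]. *)
Definition site_index (x : site) : nat :=
  nat_of_ord (val x - y + l%:R : 'Z_N)%R.

Lemma site_add_subproof (x : site) (k : int) :
  y + ((absz (((site_index x)%:Z + k) %% (l.*2.+1)%:Z)%Z)%:R - l%:R)
    \in subinterval.
Proof.
have lt_k : (absz (((site_index x)%:Z + k) %% (l.*2.+1)%:Z)%Z < l.*2.+1)%N.
  by rewrite -ltz_nat gez0_abs ?modz_ge0 ?ltz_pmod.
by apply/imsetP; exists (Ordinal lt_k).
Qed.

(* Addition on the periodic sub-interval, where [y + l + 1 = y - l]. *)
Definition site_add (x : site) (k : int) : site :=
  exist (fun z => z \in subinterval) _ (site_add_subproof x k).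

(* A spin is a boolean, [true] standing for +1 and [false] for -1. *)
Definition config := {ffun site -> bool}.

Definition swap (x : site) (eta : config) : config :=
  [ffun z => eta (tperm x (site_add x 1) z)].

(* [tau_x eta], read as a (periodic) configuration on the integers. *)
Definition shift (x : site) (eta : config) : int -> bool :=
  fun z => eta (site_add x z).

End Torus.

Section Dynamics.
Context (R : realType).

Definition spin (b : bool) : R := if b then 1 else -1.

Definition local_function (f : (int -> bool) -> R) : Prop :=
  exists m : nat, forall eta zeta : int -> bool,
    (forall z : int, (`|z| <= m)%N -> eta z = zeta z) -> f eta = f zeta.

Definition bounded_function (f : (int -> bool) -> R) : Prop :=
  exists B : R, forall eta, `|f eta| <= B.

Context (dd : (int -> bool) -> R) (N : nat) (y : 'Z_N) (l : nat).
Local Notation site := (site y l).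
Local Notation config := (config y l).

Definition exchange (x : site) (f : config -> R) (eta : config) : R :=
  f (swap x eta) - f eta.

Definition asymmetry (x : site) (eta : config) : R :=
  (~~ eta x && eta (site_add x 1))%:R - (eta x && ~~ eta (site_add x 1))%:R.

Definition generator (f : config -> R) (eta : config) : R :=
  2^-1 * N%:R ^+ 2 * \sum_(x : site) exchange x f eta +
  2^-1 * N%:R `^ (3 / 2) *
    \sum_(x : site) asymmetry x eta *
      (1 + N%:R `^ (- (1 / 2)) * dd (shift x eta)) * exchange x f eta.

Definition hyperplane (sigma : R) : {set config} :=
  [set eta : config |
    #|{: site}|%:R^-1 * (\sum_(x : site) spin (eta x)) == sigma]%SET.

Definition canonical_measure (sigma : R) (eta : config) : R :=
  if eta \in hyperplane sigma then #|hyperplane sigma|%:R^-1 else 0.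

Definition canonical_expectation (sigma : R) (f : config -> R) : R :=
  \sum_(eta : config) canonical_measure sigma eta * f eta.

(* The Radon-Nikodym derivative of the law [mu] (given by its point masses)
   with respect to [canonical_measure sigma]; it is 0 off the support. *)
Definition canonical_density (sigma : R) (mu : config -> R) (eta : config)
  : R := mu eta / canonical_measure sigma eta.

End Dynamics.

(* Main.v *)
Require Import Defs.
From HB Require Import structures.
From mathcomp Require Import all_boot all_order all_algebra.
From mathcomp Require Import perm ring lra.
From mathcomp Require Import all_classical all_reals all_analysis.

Set Implicit Arguments.
Unset Strict Implicit.
Unset Printing Implicit Defensive.

Import Order.TTheory GRing.Theory Num.Theory.
Import numFieldNormedType.Exports.

Local Open Scope classical_set_scope.
Local Open Scope ring_scope.

(* Enlarging [p], we may take an integer exponent [q >= 2].  Writing [f] for the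
   law at time [t], [d/dt sum f^q = q sum f L(f^(q-1))].  The part of the generator
   [L] without [dd] preserves the uniform measure, since the asymmetries sum to 0
   over the torus; it therefore contributes only a dissipation of order [N^2]
   along each edge.  The [dd] part has rates of order [N], so AM-GM absorbs it in
   the dissipation up to [K m sum f^q], where [m] is the number of sites and [K]
   is independent of [N].  Gronwall gives the factor [exp (K m t)], which is
   bounded because [m <= N] and [t <= C N^(-4/3)]. *)

(** * Convexity inequalities for integer powers *)

Section PowerInequalities.
Context (R : realFieldType).
Implicit Types x y : R.

(** Gap at [y] between the [n]-th power and its tangent at [x]. It serves both as the dissipation
    along an edge and as a Taylor remainder. *)
Definition bregman n x y : R := y ^+ n - x ^+ n - n%:R * x ^+ n.-1 * (y - x).

Lemma bregman2 x y : bregman 2 x y = (y - x) ^+ 2.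
Proof. by rewrite /bregman /=; ring. Qed.

(** This recursion lets both the lower and the upper bound go by induction on the exponent. *)
Lemma bregmanS n x y :
  bregman n.+3 x y = y * bregman n.+2 x y + n.+2%:R * x ^+ n.+1 * (y - x) ^+ 2.
Proof. by rewrite /bregman /= !exprS -(natr1 n.+2) -(natr1 n.+1); ring. Qed.

(** In the recursion, the first summand alone yields [(y - x) ^+ 2 * y ^+ n] and the second alone
    yields [(y - x) ^+ 2 * x ^+ n]; the two bounds are added. *)
Lemma bregman_ge n x y : 0 <= x -> 0 <= y ->
  (y - x) ^+ 2 * (x ^+ n + y ^+ n) <= 2 * bregman n.+2 x y.
Proof.
move=> x0 y0; have [d dE] : {d | d = (y - x) ^+ 2} by eexists.
have d0 : 0 <= d by rewrite dE sqr_ge0.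
rewrite -dE.
have ge_y m : d * y ^+ m <= bregman m.+2 x y.
  elim: m => [|m IH]; first by rewrite bregman2 -dE expr0 mulr1.
  rewrite bregmanS exprS -dE mulrCA ler_wpDr ?ler_wpM2l //.
  by rewrite !mulr_ge0 ?exprn_ge0.
suff ge_x : d * x ^+ n <= bregman n.+2 x y.
  by rewrite mulrDr (mulrDl 1 1) !mul1r lerD.
case: n => [|n]; first by rewrite bregman2 -dE expr0 mulr1.
rewrite bregmanS -dE ler_wpDl //.
  by rewrite mulr_ge0 // (le_trans _ (ge_y _)) // mulr_ge0 // ?exprn_ge0.
by rewrite mulrC ler_wpM2r // ler_peMl ?exprn_ge0 // ler1n.
Qed.

(** On the unit interval each step of the recursion adds at most [k * (y - x) ^+ 2], and
    [k ^+ 2 + k <= (k + 1) ^+ 2]. This bounds the second-order error of a short time step. *)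
Lemma bregman_le n x y : 0 <= x <= 1 -> 0 <= y <= 1 ->
  bregman n.+2 x y <= n.+2%:R ^+ 2 * (y - x) ^+ 2.
Proof.
move=> /andP[x0 x1] /andP[y0 y1]; have [d dE] : {d | d = (y - x) ^+ 2} by eexists.
have d0 : 0 <= d by rewrite dE sqr_ge0.
rewrite -dE; elim: n => [|n IH]; first
  by rewrite bregman2 -dE ler_peMl // expr_ge1 // ler1n.
rewrite bregmanS -dE.
have B0 : 0 <= bregman n.+2 x y.
  rewrite -(pmulr_rge0 _ (ltr0Sn R 1)) (le_trans _ (bregman_ge n x0 y0)) // -dE.
  by rewrite mulr_ge0 // addr_ge0 // ?exprn_ge0.
have xn : x ^+ n.+1 <= 1 by rewrite exprn_ile1.
have xn0 : 0 <= x ^+ n.+1 by rewrite exprn_ge0.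
apply: (@le_trans _ _ (bregman n.+2 x y + n.+2%:R * d)).
  by rewrite lerD ?ler_piMl // ler_wpM2r // ler_piMr.
apply: (le_trans (lerD IH (lexx _))).
rewrite -mulrDl ler_wpM2r // -(natr1 n.+2).
have : 0 <= n.+2%:R :> R by rewrite ler0n. by nra.
Qed.

(** By convexity the increment is at most the slope at the larger endpoint times the distance. *)
Lemma ler_dist_expS n x y : 0 <= x -> 0 <= y ->
  `|y ^+ n.+1 - x ^+ n.+1| <= n.+1%:R * `|y - x| * (x ^+ n + y ^+ n).
Proof.
move=> x0 y0; wlog le_xy : x y x0 y0 / x <= y.
  move=> H; have [xy|/ltW yx] := leP x y; first exact: H.
  by rewrite distrC (distrC y) (addrC (x ^+ n)); apply: H.
rewrite !ger0_norm ?subr_ge0 ?lerXn2r // mulrDr ler_wpDl //.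
  by rewrite !mulr_ge0 ?subr_ge0 // ?exprn_ge0.
case: n => [|n]; first by rewrite !expr1 expr0 !mul1r mulr1.
have : 0 <= 2 * bregman n.+2 y x.
  apply: le_trans (bregman_ge n y0 x0).
  by rewrite mulr_ge0 ?sqr_ge0 // addr_ge0 // ?exprn_ge0.
rewrite pmulr_rge0 // /bregman /=; set a := _ * _ * y ^+ n.+1.
have -> : a = - (n.+2%:R * y ^+ n.+1 * (x - y)) by rewrite /a; ring.
lra.
Qed.

(* The Bregman divergence is the dissipation along an edge with rate [r]; it
   absorbs the non-conservative part [e] of the rate by AM-GM. *)
Lemma edge_inequality n x y (c eps r e : R) : 0 <= x -> 0 <= y ->
  0 < c -> c <= r -> `|e| <= eps ->
  n.+2%:R * (x * ((r + e) * (y ^+ n.+1 - x ^+ n.+1))) <=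
  n.+1%:R * (r * (y ^+ n.+2 - x ^+ n.+2)) +
  (eps * n.+2%:R * n.+1%:R) ^+ 2 / c * (x ^+ n.+2 + y ^+ n.+2).
Proof.
move=> x0 y0 c0 cr eeps.
have eps0 : 0 <= eps by rewrite (le_trans _ eeps).
set k := eps * n.+2%:R * n.+1%:R; set w := x ^+ n + y ^+ n.
have xn : 0 <= x ^+ n by rewrite exprn_ge0.
have yn : 0 <= y ^+ n by rewrite exprn_ge0.
have w0 : 0 <= w by rewrite addr_ge0.
have k0 : 0 <= k by rewrite !mulr_ge0.
have dissip : c * ((x - y) ^+ 2 * w) <= 2 * (r * bregman n.+2 y x).
  rewrite [leRHS]mulrCA /w (addrC (x ^+ n)) ler_pM ?bregman_ge ?(ltW c0) //.
  by rewrite mulr_ge0 ?sqr_ge0 ?addr_ge0.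
have pert : n.+2%:R * (x * (e * (y ^+ n.+1 - x ^+ n.+1))) <=
            k * (x * `|x - y|) * w.
  apply: le_trans (ler_norm _) _.
  rewrite !normrM normr_nat (ger0_norm x0).
  have -> : k * (x * `|x - y|) * w =
    n.+2%:R * (x * (eps * (n.+1%:R * `|y - x| * w))).
    by rewrite /k (distrC x); ring.
  by rewrite !ler_wpM2l // ler_pM // ler_dist_expS.
(* The difference of the two sides is a complete square divided by [c]. *)
have amgm : k * (x * `|x - y|) * 2 <= c * (x - y) ^+ 2 + k ^+ 2 / c * x ^+ 2.
  rewrite -subr_ge0 -[(x - y) ^+ 2]real_normK ?num_real //.
  have -> : c * `|x - y| ^+ 2 + k ^+ 2 / c * x ^+ 2 - k * (x * `|x - y|) * 2 =
    (c * `|x - y| - k * x) ^+ 2 / c by field; rewrite gt_eqF.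
  by rewrite divr_ge0 ?sqr_ge0 ?ltW.
have xw : x ^+ 2 * w <= 2 * (x ^+ n.+2 + y ^+ n.+2).
  suff : x ^+ 2 * y ^+ n <= x ^+ n.+2 + y ^+ n.+2.
    have : 0 <= y ^+ n.+2 by rewrite exprn_ge0.
    by rewrite /w mulrDr -exprD add2n; lra.
  have [xy|/ltW yx] := leP x y.
    rewrite ler_wpDl ?exprn_ge0 // -(add2n n) (exprD y) ler_wpM2r //.
    by rewrite lerXn2r.
  rewrite ler_wpDr ?exprn_ge0 // -(add2n n) (exprD _ 2 n) ler_wpM2l ?sqr_ge0 //.
  by rewrite lerXn2r.
(* Exact splitting: the rate [r] produces an increment of the power [n.+2], which invariance will
   cancel, minus a divergence based at [y]. *)
have split_edge : n.+2%:R * (x * ((r + e) * (y ^+ n.+1 - x ^+ n.+1))) =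
   n.+1%:R * (r * (y ^+ n.+2 - x ^+ n.+2)) - r * bregman n.+2 y x +
   n.+2%:R * (x * (e * (y ^+ n.+1 - x ^+ n.+1))).
  by rewrite /bregman /= !exprS -(natr1 n.+1); ring.
rewrite split_edge.
have kc : 0 <= k ^+ 2 / c by rewrite divr_ge0 ?sqr_ge0 ?ltW.
have := ler_wpM2r w0 amgm; have := ler_wpM2l kc xw.
rewrite mulrDl -!mulrA.
move: (k ^+ 2 / c) kc => K _.
move: dissip pert. rewrite -!mulrA.
lra.
Qed.

End PowerInequalities.

(** * The periodic interval and the growth of power sums under the generator *)

Section Sites.
Context (N : nat) (y : 'Z_N) (l : nat).
Hypotheses (N_gt1 : (1 < N)%N) (le_lN : (l.*2.+1 <= N)%N).
Implicit Types (x : site y l) (eta : config y l).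

Lemma card_site : (#|{: site y l}| <= N)%N.
Proof. by rewrite card_sig (leq_trans (max_card _)) // card_ord Zp_cast. Qed.

Lemma natr_Zp_inj (i j : nat) : (i < N)%N -> (j < N)%N ->
  i%:R = j%:R :> 'Z_N -> i = j.
Proof.
by move=> iN jN /(congr1 val) /=; rewrite !val_Zp_nat // !modn_small.
Qed.

Lemma site_index_lt x : (site_index x < l.*2.+1)%N.
Proof.
rewrite /site_index; have /imsetP[i _ ->] := valP x.
rewrite (addrC y) addrK subrK val_Zp_nat // modn_small //.
exact: leq_trans (ltn_ord i) le_lN.
Qed.

Lemma site_index_inj : injective (@site_index N y l).
Proof. by move=> x x' /val_inj/addIr/addIr/val_inj. Qed.

(** Since [2 l + 1 <= N], indices do not wrap around in ['Z_N], so the claim reduces to the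
    successor modulo [2 l + 1]. *)
Lemma site_add1_inj : injective (fun x => site_add x 1).
Proof.
have index_mod x : absz (((site_index x)%:Z + 1) %% (l.*2.+1)%:Z)%Z =
                   ((site_index x).+1 %% l.*2.+1)%N.
  by rewrite -PoszD addn1 modz_nat.
move=> x x' /(congr1 val) /= /addrI/addIr; rewrite !index_mod => /natr_Zp_inj H.
have {}H : (site_index x + 1 == site_index x' + 1 %[mod l.*2.+1])%N.
  by rewrite !addn1; apply/eqP/H; rewrite (leq_trans _ le_lN) // ltn_mod.
rewrite eqn_modDr in H; apply/site_index_inj.
by have /eqP := H; rewrite !modn_small ?site_index_lt.
Qed.

Lemma swapK x : involutive (@swap N y l x).
Proof. by move=> eta; apply/ffunP => z; rewrite !ffunE tpermK. Qed.

Context (R : realType).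

Lemma asymmetry_swap x eta : asymmetry R x (swap x eta) = - asymmetry R x eta.
Proof.
rewrite /asymmetry !ffunE tpermL tpermR opprB.
by case: (eta x); case: (eta _).
Qed.

Lemma normr_asymmetry x eta : `|asymmetry R x eta| <= 1.
Proof.
rewrite /asymmetry; case: (eta x); case: (eta _) => /=;
  by rewrite ?subrr ?subr0 ?sub0r ?normrN ?normr0 ?normr1.
Qed.

(** Each asymmetry is half the spin difference across its edge, and these differences telescope
    around the torus. *)
Lemma sum_asymmetry eta : \sum_x asymmetry R x eta = 0.
Proof.
transitivity (\sum_x (spin R (eta (site_add x 1)) / 2 - spin R (eta x) / 2)).
  apply: eq_bigr => x _; rewrite /asymmetry /spin.
  by case: (eta x); case: (eta _) => /=; lra.
rewrite sumrB [X in _ - X](reindex_inj site_add1_inj) subrr //.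
Qed.

Lemma sum_swap x (g : config y l -> R) :
  \sum_eta g (swap x eta) = \sum_eta g eta.
Proof. by rewrite [RHS](reindex_inj (inv_inj (swapK x))). Qed.

(* The uniform measure is invariant when [dd = 0]. *)
Lemma sum_exchange_conservative (a b : R) (g : config y l -> R) :
  \sum_x \sum_eta (a + b * asymmetry R x eta) * exchange x g eta = 0.
Proof.
(* Changing variables by the swap cancels the [a] terms and doubles the [b] terms, because the
   asymmetry changes sign. *)
transitivity (\sum_x \sum_eta (- 2 * b * g eta) * asymmetry R x eta).
  apply: eq_bigr => x _; rewrite /exchange.
  under eq_bigr do rewrite mulrBr.
  rewrite sumrB -(sum_swap x) -sumrB; apply: eq_bigr => eta _.
  by rewrite swapK asymmetry_swap; ring.
rewrite exchange_big big1 // => eta _.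
by rewrite -mulr_sumr sum_asymmetry mulr0.
Qed.

(** Collects the rate of each edge; as [N^(3/2) * N^(-1/2) = N], the [dd] part has order [N]. *)
Lemma generatorE (dd : (int -> bool) -> R) (f : config y l -> R) eta :
  generator dd f eta =
  \sum_x (2^-1 * N%:R ^+ 2 + 2^-1 * N%:R `^ (3 / 2) * asymmetry R x eta +
          2^-1 * N%:R * (asymmetry R x eta * dd (Defs.shift x eta))) *
         exchange x f eta.
Proof.
have N0 : (N%:R : R) != 0 by rewrite pnatr_eq0 -lt0n (ltn_trans _ N_gt1).
have powN : N%:R `^ (3 / 2) * N%:R `^ (- (1 / 2)) = N%:R :> R.
  rewrite -powRD; last by rewrite N0 implybT.
  by rewrite (_ : 3 / 2 + _ = 1) ?powRr1 //; lra.
rewrite /generator !mulr_sumr -big_split; apply: eq_bigr => x _ /=.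
by rewrite -[in 2^-1 * N%:R * _]powN; ring.
Qed.

(** Amounts to [4 <= 3 * sqrt N], true from [N = 2] on. It keeps the conservative rate of every edge
    above [N^2 / 8]. *)
Lemma powR32_le : 4 * N%:R `^ (3 / 2) <= 3 * (N%:R : R) ^+ 2.
Proof.
have N2 : 2 <= (N%:R : R) by rewrite (ler_nat R 2).
have s2 : N%:R `^ (1 / 2) ^+ 2 = N%:R :> R.
  by rewrite -powR_mulrn ?powR_ge0 // -powRrM mul1r mulVf ?powRr1.
have -> : N%:R `^ (3 / 2) = N%:R `^ (1 / 2) ^+ 3 :> R.
  by rewrite -powR_mulrn ?powR_ge0 // -powRrM mul1r mulrC.
have s0 : 0 <= N%:R `^ (1 / 2) :> R by rewrite powR_ge0.
move: (N%:R `^ (1 / 2)) s0 s2 => s s0 s2.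
rewrite -s2 -exprM (_ : 2 * 2 = 1 + 3)%N // exprD mulrA ler_wpM2r ?exprn_ge0 //.
nra.
Qed.

(** The edge inequality is summed over edges and configurations. The conservative increments vanish;
    each edge error [2 K] is counted for [eta] and for its swap, whence the factor 4. *)
Lemma moment_growth (dd : (int -> bool) -> R) (B : R) (n : nat)
  (f : config y l -> R) : (forall zeta : int -> bool, `|dd zeta| <= B) ->
  (forall eta, 0 <= f eta) ->
  n.+2%:R * (\sum_eta f eta * generator dd (fun z => f z ^+ n.+1) eta) <=
  4 * (B * n.+2%:R * n.+1%:R) ^+ 2 * #|{: site y l}|%:R *
    \sum_eta f eta ^+ n.+2.
Proof.
move=> ddB f0; set K := (B * n.+2%:R * n.+1%:R) ^+ 2.
have N0 : 0 < (N%:R : R) by rewrite ltr0n (ltn_trans _ N_gt1).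
pose r x eta := 2^-1 * N%:R ^+ 2 + 2^-1 * N%:R `^ (3 / 2) * asymmetry R x eta.
have edge x eta : n.+2%:R * (f eta * ((r x eta +
      2^-1 * N%:R * (asymmetry R x eta * dd (Defs.shift x eta))) *
      exchange x (fun z => f z ^+ n.+1) eta)) <=
   n.+1%:R * (r x eta * exchange x (fun z => f z ^+ n.+2) eta) +
   2 * K * (f eta ^+ n.+2 + f (swap x eta) ^+ n.+2).
  have c0 : 0 < 8^-1 * N%:R ^+ 2 :> R by rewrite mulr_gt0 ?exprn_gt0.
  (* With [eps = N B / 2] and [c = N^2 / 8], the powers of [N] cancel in the AM-GM constant. *)
  have -> : 2 * K = (2^-1 * N%:R * B * n.+2%:R * n.+1%:R) ^+ 2 /
                    (8^-1 * N%:R ^+ 2).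
    by rewrite /K; field; rewrite gt_eqF.
  apply: edge_inequality => //.
    have := powR32_le; have := normr_asymmetry x eta.
    have : 0 <= N%:R `^ (3 / 2) :> R by rewrite powR_ge0.
    rewrite /r ler_norml; nra.
  have N20 : 0 <= 2^-1 * N%:R :> R by rewrite mulr_ge0 ?invr_ge0 // ltW.
  rewrite normrM (ger0_norm N20) ler_wpM2l // normrM -[leRHS]mul1r.
  by rewrite ler_pM ?normr_asymmetry.
have -> : n.+2%:R * (\sum_eta f eta * generator dd (fun z => f z ^+ n.+1) eta)
  = \sum_x \sum_eta n.+2%:R * (f eta * ((r x eta +
      2^-1 * N%:R * (asymmetry R x eta * dd (Defs.shift x eta))) *
      exchange x (fun z => f z ^+ n.+1) eta)).
  rewrite mulr_sumr exchange_big; apply: eq_bigr => eta _.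
  by rewrite generatorE !mulr_sumr.
apply: le_trans (ler_sum _ (fun x _ => ler_sum _ (fun eta _ => edge x eta))) _.
under eq_bigr do rewrite big_split -!mulr_sumr /=.
rewrite big_split -!mulr_sumr /= sum_exchange_conservative mulr0 add0r.
under eq_bigr do rewrite big_split /= (sum_swap _ (fun z => f z ^+ n.+2)).
by rewrite sumr_const -mulr_natr le_eqVlt; apply/orP; left; apply/eqP; ring.
Qed.

End Sites.

(** * A Gronwall bound for power sums along a finite Markov semigroup *)

Section Semigroup.
Context (R : realType) (E : finType).
Context (Q : R -> E -> E -> R) (L : (E -> R) -> E -> R).
Hypotheses (Q_semigroup : markov_semigroup Q) (QL : has_generator Q L).

(** The dual action of the semigroup, which transports laws as row vectors. *)
Definition push (mu : E -> R) (t : R) (y : E) : R := \sum_x mu x * Q t x y.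

(** [L] is a pointwise limit of linear operators, hence linear, and can be handled as a matrix. *)
Lemma generator_sum (f : E -> R) x :
  L f x = \sum_y f y * L (fun z => (z == y)%:R) x.
Proof.
have /norm_cvg_unique := @QL f x; apply.
have act_delta t y : semigroup_act Q t (fun z => (z == y)%:R) x = Q t x y.
  rewrite /semigroup_act (bigD1 y) //= eqxx mulr1 big1 ?addr0 // => z /negPf ->.
  by rewrite mulr0.
have -> : (fun t => t^-1 * (semigroup_act Q t f x - f x)) = (fun t => \sum_y
    f y * (t^-1 * (semigroup_act Q t (fun z => (z == y)%:R) x - (x == y)%:R))).
  apply/funext => t; rewrite {1}/semigroup_act.
  have -> : f x = \sum_y f y * (x == y)%:R.
    rewrite (bigD1 x) //= eqxx mulr1 big1 ?addr0 // => z /negPf.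
    by rewrite eq_sym => ->; rewrite mulr0.
  rewrite -sumrB mulr_sumr; apply: eq_bigr => y _.
  by rewrite -/(semigroup_act Q t _ x) act_delta; ring.
apply: cvg_big => [u|y _]; first exact: add_continuous.
apply: cvgMl_tmp; exact: (@QL (fun z => (z == y)%:R) x).
Qed.

(** Finitely many entries, so the first-order expansion of [Q] at time 0 is uniform over them. *)
Lemma near_generator (e : R) : 0 < e -> \forall h \near 0^'+,
  forall x y, `|Q h x y - (x == y)%:R - h * L (fun z => (z == y)%:R) x| <= e * h.
Proof.
move=> e0.
have near_xy x y : \forall h \near 0^'+,
    `|Q h x y - (x == y)%:R - h * L (fun z => (z == y)%:R) x| <= e * h.
  have /cvgrPdist_le/(_ _ e0) := @QL (fun z => (z == y)%:R) x.
  apply: filterS2 (nbhs_right_gt 0) => h h0.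
  rewrite /semigroup_act (bigD1 y) //= eqxx mulr1 big1 ?addr0; last first.
    by move=> z /negPf ->; rewrite mulr0.
  rewrite distrC => /(ler_wpM2r (ltW h0)); apply: le_trans.
  rewrite -[X in _ <= _ * X](gtr0_norm h0) -normrM mulrBl mulrAC mulVf ?gt_eqF // mul1r.
  by rewrite (mulrC h).
apply: filter_forall => x; exact: filter_forall.
Qed.

Lemma push_ge0 mu t y : 0 <= t -> (forall x, 0 <= mu x) -> 0 <= push mu t y.
Proof.
move=> t0 mu0; apply: sumr_ge0 => x _.
by rewrite mulr_ge0 // (semigroup_ge0 Q_semigroup).
Qed.

Lemma sum_push mu t : 0 <= t -> \sum_y push mu t y = \sum_x mu x.
Proof.
move=> t0; rewrite exchange_big; apply: eq_bigr => x _.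
by rewrite -mulr_sumr (semigroup_sum1 Q_semigroup) // mulr1.
Qed.

Lemma pushD mu s t y : 0 <= s -> 0 <= t ->
  push mu (s + t) y = push (push mu s) t y.
Proof.
move=> s0 t0; rewrite /push.
under [RHS]eq_bigr do rewrite mulr_suml.
rewrite exchange_big; apply: eq_bigr => x _.
rewrite (semigroupD Q_semigroup) // mulr_sumr.
by apply: eq_bigr => z _; rewrite mulrA.
Qed.

Lemma push0 mu y : push mu 0 y = mu y.
Proof.
rewrite /push (bigD1 y) //= (semigroup_0 Q_semigroup) eqxx mulr1 big1 ?addr0 //.
by move=> x /negPf xy; rewrite (semigroup_0 Q_semigroup) xy mulr0.
Qed.

Context (n : nat) (C : R).
Hypotheses (C_ge0 : 0 <= C) (growth : forall f : E -> R, (forall x, 0 <= f x) ->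
  n.+2%:R * (\sum_x f x * L (fun z => f z ^+ n.+1) x) <=
    C * \sum_x f x ^+ n.+2).

Definition probability_vector (mu : E -> R) :=
  (forall x, 0 <= mu x) /\ \sum_x mu x = 1.

Lemma probability_vector_le1 mu x : probability_vector mu -> 0 <= mu x <= 1.
Proof.
by move=> [mu0 <-]; rewrite mu0 (bigD1 x) //= lerDl sumr_ge0.
Qed.

Lemma probability_vector_push mu t :
  0 <= t -> probability_vector mu -> probability_vector (push mu t).
Proof.
by move=> t0 [mu0 mu1]; split=> [x|]; [apply: push_ge0|rewrite sum_push].
Qed.

(* The error is uniform in [mu], so that the step can be iterated. *)
Lemma near_moment_step (e : R) : 0 < e -> \forall h \near 0^'+,
  forall mu, probability_vector mu ->
  \sum_x push mu h x ^+ n.+2 <= (1 + C * h) * (\sum_x mu x ^+ n.+2) + e * h.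
Proof.
move=> e0.
pose A x y := L (fun z => (z == y)%:R) x.
pose M : R := 1 + \sum_x \sum_y `|A x y|.
have M0 : 0 < M by rewrite ltr_wpDr ?ltr01 // !sumr_ge0 // => *; rewrite sumr_ge0.
have AM x y : `|A x y| + 1 <= M.
  rewrite addrC lerD2l (bigD1 x) //= (bigD1 y) //= -addrA lerDl.
  by rewrite addr_ge0 ?sumr_ge0 // => *; rewrite sumr_ge0.
(* [c] is positive and dominates the number of states. [e1] and [h1] each let one error term cost at
   most [e / 2] after summation; capping [e1] at 1 serves the crude bound [D_le]. *)
pose c : R := #|E|%:R + 1.
have c0 : 0 < c by rewrite ltr_wpDl.
pose e1 : R := Num.min 1 (e / (2 * n.+2%:R * c)).
have e10 : 0 < e1.
  by rewrite lt_min ltr01 divr_gt0 // !mulr_gt0 // ltr0n.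
pose h1 : R := e / (2 * n.+2%:R ^+ 2 * M ^+ 2 * c).
have h10 : 0 < h1 by rewrite divr_gt0 // !mulr_gt0 // ?exprn_gt0 // ltr0n.
apply: filterS3 (near_generator e10) (nbhs_right_gt 0) (nbhs_right_le h10).
move=> h Qh h0 hh1 mu mu_prob.
have [mu0 mu1] := mu_prob.
pose D y := push mu h y - mu y.
have D_approx y : `|D y - h * \sum_x mu x * A x y| <= e1 * h.
  have -> : D y - h * (\sum_x mu x * A x y) =
            \sum_x mu x * (Q h x y - (x == y)%:R - h * A x y).
    rewrite /D -[in X in _ - X - _](push0 mu y) /push mulr_sumr -!sumrB.
    by apply: eq_bigr => x _; rewrite (semigroup_0 Q_semigroup); ring.
  apply: le_trans (ler_norm_sum _ _ _) _.
  have -> : e1 * h = \sum_x mu x * (e1 * h) by rewrite -mulr_suml mu1 mul1r.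
  apply: ler_sum => x _.
  rewrite normrM (ger0_norm (mu0 x)) ler_wpM2l //; exact: Qh.
have D_le y : `|D y| <= M * h.
  rewrite -(subrK (h * \sum_x mu x * A x y) (D y)).
  apply: le_trans (ler_normD _ _) _.
  have e11 : e1 * h <= 1 * h by rewrite ler_wpM2r ?(ltW h0) // ge_min lexx.
  apply: (@le_trans _ _ (1 * h + (M - 1) * h)); last first.
    by rewrite -mulrDl addrC subrK.
  rewrite lerD ?(le_trans (D_approx y)) //.
  rewrite normrM (gtr0_norm h0) mulrC ler_wpM2r ?(ltW h0) //.
  apply: le_trans (ler_norm_sum _ _ _) _.
  have -> : M - 1 = \sum_x mu x * (M - 1) by rewrite -mulr_suml mu1 mul1r.
  apply: ler_sum => x _.
  by rewrite normrM (ger0_norm (mu0 x)) ler_wpM2l // lerBrDr.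
(* Taylor expansion at [mu y]: the remainder is a Bregman divergence between numbers in the unit
   interval, of order [h ^+ 2] by [D_le]. *)
have step y : push mu h y ^+ n.+2 <= mu y ^+ n.+2 +
    h * (n.+2%:R * (mu y ^+ n.+1 * \sum_x mu x * A x y)) +
    (n.+2%:R * e1 + n.+2%:R ^+ 2 * M ^+ 2 * h) * h.
  have mu01 := probability_vector_le1 y mu_prob.
  have push01 := probability_vector_le1 y
    (probability_vector_push (ltW h0) mu_prob).
  have := bregman_le n mu01 push01; rewrite /bregman /= -/(D y).
  have D2 : D y ^+ 2 <= M ^+ 2 * h * h.
    rewrite -mulrA -expr2 -exprMn -[D y ^+ 2]real_normK ?num_real //.
    by rewrite lerXn2r ?nnegrE ?normr_ge0 // mulr_ge0 ?ltW.
  have first_order : n.+2%:R * mu y ^+ n.+1 * D y <=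
      h * (n.+2%:R * (mu y ^+ n.+1 * \sum_x mu x * A x y)) + n.+2%:R * e1 * h.
    have -> : h * (n.+2%:R * (mu y ^+ n.+1 * \sum_x mu x * A x y)) +
      n.+2%:R * e1 * h = n.+2%:R * (mu y ^+ n.+1 *
        (h * \sum_x mu x * A x y) + 1 * (e1 * h)) by ring.
    rewrite -mulrA ler_wpM2l // -lerBlDl -mulrBr.
    apply: le_trans (ler_norm _) _.
    rewrite normrM ler_pM // ger0_norm ?exprn_ge0 ?exprn_ile1 //;
      by case/andP: mu01.
  have nD2 := ler_wpM2l (sqr_ge0 (n.+2%:R : R)) D2.
  move: first_order nD2; lra.
apply: le_trans (ler_sum _ (fun y _ => step y)) _.
rewrite 2!big_split /= sumr_const -mulr_sumr.
(* Linearity of [L] turns the first-order term into the quantity controlled by [growth]. *)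
have -> : \sum_y n.+2%:R * (mu y ^+ n.+1 * \sum_x mu x * A x y) =
          n.+2%:R * (\sum_x mu x * L (fun z => mu z ^+ n.+1) x).
  rewrite -mulr_sumr; congr (_ * _).
  under [RHS]eq_bigr do rewrite generator_sum mulr_sumr.
  rewrite exchange_big; apply: eq_bigr => y _ /=.
  by rewrite mulr_sumr; apply: eq_bigr => x _; rewrite /A; ring.
have := ler_wpM2l (ltW h0) (growth mu0).
suff : ((n.+2%:R * e1 + n.+2%:R ^+ 2 * M ^+ 2 * h) * h) *+ #|E| <= e * h.
  by move: (\sum_x mu x ^+ n.+2) => F; lra.
rewrite -mulrnAl ler_wpM2r ?(ltW h0) // -mulr_natr.
have -> : e = (n.+2%:R * (e / (2 * n.+2%:R * c)) +
               n.+2%:R ^+ 2 * M ^+ 2 * h1) * c.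
  by rewrite /h1; field; rewrite !gt_eqF // ltr0n.
have M2 : 0 <= n.+2%:R ^+ 2 * M ^+ 2 by rewrite mulr_ge0 ?sqr_ge0.
apply: ler_pM => //.
- by rewrite addr_ge0 // mulr_ge0 // ltW.
- by rewrite lerD ?ler_wpM2l // ge_min lexx orbT.
- by rewrite lerDl.
Qed.

(** Discrete Gronwall: cut the time into [k.+1] equal short steps, iterate the one-step bound, and
    use [1 + C h <= expR (C h)]. *)
Lemma moment_le mu t : 0 <= t -> probability_vector mu ->
  \sum_x push mu t x ^+ n.+2 <= expR (C * t) * \sum_x mu x ^+ n.+2.
Proof.
move=> t0 mu_prob; have [->|t_neq0] := eqVneq t 0.
  by rewrite mulr0 expR0 mul1r; under eq_bigr do rewrite push0.
have {t_neq0}t_gt0 : 0 < t by rewrite lt_def t_neq0.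
set F0 := \sum_x mu x ^+ n.+2.
have C_exp : 0 < expR (C * t) * t by rewrite mulr_gt0 ?expR_gt0.
apply/ler_addgt0Pr => e e0.
(* Chosen so that the accumulated error [expR (C * t) * e1 * t] equals [e]. *)
pose e1 := e / (expR (C * t) * t).
have e10 : 0 < e1 by rewrite divr_gt0.
have [k Hk] : exists k : nat, forall nu, probability_vector nu ->
    \sum_x push nu (t / k.+1%:R) x ^+ n.+2 <=
    (1 + C * (t / k.+1%:R)) * (\sum_x nu x ^+ n.+2) + e1 * (t / k.+1%:R).
  have [/= d d0 Hd] := near_moment_step e10.
  pose k := Num.truncn (t / d).
  have hk0 : 0 < t / k.+1%:R by rewrite divr_gt0 // ltr0n.
  exists k => nu; apply: Hd => //=.
  rewrite sub0r normrN gtr0_norm // ltr_pdivrMr ?ltr0n // mulrC -ltr_pdivrMr //.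
  exact: truncnS_gt.
pose h := t / k.+1%:R; pose g := 1 + C * h.
have h0 : 0 <= h by rewrite divr_ge0.
have g1 : 1 <= g by rewrite lerDl mulr_ge0.
have iter j : \sum_x push mu (h *+ j) x ^+ n.+2 <= g ^+ j * (F0 + e1 * h *+ j).
  elim: j => [|j IH].
    by rewrite mul1r mulr0n addr0; under eq_bigr do rewrite push0.
  under eq_bigr do rewrite mulrSr pushD ?mulrn_wge0 //.
  apply: le_trans (Hk _ _) _.
    by apply: probability_vector_push => //; rewrite mulrn_wge0.
  rewrite -/h -/g.
  apply: (@le_trans _ _ (g * (g ^+ j * (F0 + e1 * h *+ j)) + g ^+ j.+1 * (e1 * h))).
    apply: lerD; first by rewrite ler_wpM2l // (le_trans ler01).
    by rewrite ler_peMl ?exprn_ege1 // mulr_ge0 // ltW.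
  by rewrite exprS mulrSr; lra.
have ht : h *+ k.+1 = t by rewrite -mulr_natr divfK // pnatr_eq0.
have := iter k.+1; rewrite -mulrnAr ht => /le_trans; apply.
have gk : g ^+ k.+1 <= expR (C * t).
  rewrite -ht mulrnAr -mulr_natr expRM_natr lerXn2r ?nnegrE ?expR_ge0 ?(le_trans ler01) //.
  exact: expR_ge1Dx.
have -> : expR (C * t) * F0 + e = expR (C * t) * (F0 + e1 * t).
  by rewrite mulrDr; congr (_ + _); rewrite /e1; field; rewrite !gt_eqF ?expR_gt0.
rewrite ler_wpM2r // addr_ge0 //; last by rewrite mulr_ge0 // ltW.
by rewrite sumr_ge0 // => x _; rewrite exprn_ge0 //; case: mu_prob.
Qed.

End Semigroup.

(** * The law of the process as the evolved initial law *)

Section Law.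
Context (R : realType) (E : finType) (d : measure_display)
  (Omega : measurableType d) (P : probability Omega R) (X : R -> Omega -> E)
  (Q : R -> E -> E -> R).

(** Splits the event by the value at time 0 and applies the Markov property with that single past
    time. *)
Lemma law_push (t : R) (y : E) :
  (forall (s : R) (A : set E), 0 <= s -> measurable (X s @^-1` A)) ->
  markov_property P X Q -> 0 <= t -> law P X t y = push Q (law P X 0) t y.
Proof.
move=> Xmeas markov t0.
have step x : P (X 0 @^-1` [set x] `&` X t @^-1` [set y]) =
              (law P X 0 x * Q t x y)%:E.
  have := markov 0%N (fun=> 0) (fun=> x) t y (lexx _) (fun _ _ => lexx _) t0.
  rewrite /= bigcap_mkord big_ord1 subr0 => ->.
  by rewrite EFinM fineK // fin_num_measure //; exact: Xmeas.
have cover : X t @^-1` [set y] = \big[setU/set0]_(x \in [set` index_enum E])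
    (X 0 @^-1` [set x] `&` X t @^-1` [set y]).
  rewrite fsbig_setU //; apply/seteqP; split => [w Xw|w [x _ []] //].
  by exists (X 0 w); rewrite /= ?mem_index_enum.
rewrite /law cover measure_fsbig //; first last.
- by apply: trivIset_setIr; exact: trivIset_preimage1.
- by move=> x _; apply: measurableI; exact: Xmeas.
rewrite -fsbig_seq ?index_enum_uniq //.
rewrite (eq_bigr (fun x => (law P X 0 x * Q t x y)%:E)) ?sumEFin //.
by move=> x _; exact: step.
Qed.

End Law.

(** * Moments of the density in terms of power sums of the law *)

Lemma powR_le1D_expr (R : realType) (p x : R) (n : nat) :
  0 < p -> p <= n%:R -> 0 <= x -> x `^ p <= 1 + x ^+ n.
Proof.
move=> p0 pn x0; have [x1|/ltW x1] := leP x 1.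
  have -> : 1 = (1 : R) `^ p by rewrite powR1.
  by rewrite ler_wpDr ?exprn_ge0 // ge0_ler_powR ?nnegrE // ltW.
by rewrite ler_wpDl // -powR_mulrn // ler_powR.
Qed.

Section CanonicalMeasure.
Context (R : realType) (N : nat) (y : 'Z_N) (l : nat) (sigma : R).
Hypothesis hyperplane_neq0 : hyperplane y l sigma != finset.set0.
Local Notation H := (hyperplane y l sigma).

Lemma card_hyperplane_gt0 : 0 < #|H|%:R :> R.
Proof. by rewrite ltr0n card_gt0. Qed.

Lemma sum_canonical_measureX n :
  \sum_(z : config y l) canonical_measure sigma z ^+ n.+1 = #|H|%:R ^- n.
Proof.
have H0 := card_hyperplane_gt0.
under eq_bigr => z _ do
  rewrite /canonical_measure (fun_if (fun x => x ^+ n.+1)) expr0n /=.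
rewrite -big_mkcond sumr_const -[LHS]mulr_natr exprVn exprS invfM mulrAC mulVf //.
  by rewrite mul1r.
by rewrite gt_eqF.
Qed.

Lemma canonical_measure_probability :
  probability_vector (canonical_measure sigma : config y l -> R).
Proof.
split=> [z|]; first by rewrite /canonical_measure; case: ifP => // _; rewrite invr_ge0.
by have := sum_canonical_measureX 0; rewrite expr0 invr1.
Qed.

(** On the hyperplane the density is [#|H| * mu], and the uniform weight removes one factor [#|H|];
    elsewhere the weight is zero. *)
Lemma canonical_density_moment (mu : config y l -> R) (p : R) (n : nat) :
  0 < p -> p <= n.+1%:R -> (forall z, 0 <= mu z) ->
  canonical_expectation sigma
    (fun z => `|canonical_density sigma mu z| `^ p) <=
  1 + #|H|%:R ^+ n * \sum_z mu z ^+ n.+1.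
Proof.
move=> p0 pn mu0; have [cm0 cm1] := canonical_measure_probability.
have H0 := card_hyperplane_gt0.
rewrite -[X in X + _]cm1 mulr_sumr -big_split; apply: ler_sum => z _ /=.
apply: (@le_trans _ _ (canonical_measure sigma z *
    (1 + canonical_density sigma mu z ^+ n.+1))).
  have dens0 : 0 <= canonical_density sigma mu z by rewrite divr_ge0.
  by rewrite ler_wpM2l // (ger0_norm dens0) powR_le1D_expr.
rewrite mulrDr mulr1 lerD2l /canonical_density /canonical_measure.
case: ifP => _; last by rewrite mul0r mulr_ge0 ?exprn_ge0.
by rewrite invrK exprMn (exprS #|H|%:R) mulrCA mulKf ?gt_eqF // mulrC.
Qed.

End CanonicalMeasure.

(** * The uniform moment bound *)

Theorem lemma8p5 (R : realType) (dd : (int -> bool) -> R)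
  (dd_local : local_function dd) (dd_bounded : bounded_function dd)
  (beta : R) (beta_gt0 : 0 < beta) (p : R) (p_ge1 : 1 <= p)
  (tau : nat -> R)
  (tau_small : lesssim tau (fun N : nat => N%:R `^ (- (4 / 3)))) :
  exists C : R,
  forall (N : nat) (y : 'Z_N) (upsilon : R) (l : nat) (sigma : R)
    (d : measure_display) (Omega : measurableType d)
    (P : probability Omega R) (eta : R -> Omega -> config y l) (t : R),
    0 < upsilon <= 1 / 3 + beta ->
    l = Num.truncn (N%:R `^ upsilon : R) ->
    (l.*2.+1 <= N)%N ->
    -1 <= sigma <= 1 ->
    hyperplane y l sigma != finset.set0 ->
    markov_process P eta (generator dd (y := y) (l := l)) ->
    (forall zeta, law P eta 0 zeta = canonical_measure sigma zeta) ->
    0 <= t <= tau N ->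
    canonical_expectation sigma
      (fun zeta => `|canonical_density sigma (law P eta t) zeta| `^ p) <= C.
Proof.
have [B ddB] := dd_bounded; have [Ct tauC] := tau_small.
(* The integer exponent is [n.+2], which exceeds [p]. *)
pose n := Num.truncn p.
pose K : R := 4 * (B * n.+2%:R * n.+1%:R) ^+ 2.
have K0 : 0 <= K by rewrite mulr_ge0 ?sqr_ge0.
exists (1 + expR (K * `|Ct|)).
move=> N y upsilon l sigma d Omega P eta t /andP[ups0 _] lE lN _ H0.
move=> [eta_meas [Q [Q_semigroup QL markov]]] law0 /andP[t0 t_tau].
(* [N = 1] would force [l = 1] and thus [3 <= 1]. *)
have N_gt1 : (1 < N)%N.
  rewrite ltn_neqAle (leq_trans _ lN) // andbT.
  by apply/eqP => N1; move: lN; rewrite lE -N1 powR1 truncn1.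
have NR0 : 0 < N%:R :> R by rewrite ltr0n ltnW.
have cm_prob := canonical_measure_probability H0.
have lawE z : law P eta t z = push Q (canonical_measure sigma) t z.
  by rewrite (law_push _ eta_meas markov t0) /push; under eq_bigr do rewrite law0.
have law_ge0 z : 0 <= law P eta t z by rewrite fine_ge0.
have p_gt0 : 0 < p by rewrite (lt_le_trans ltr01).
have pn : p <= n.+2%:R.
  by rewrite (le_trans (ltW (truncnS_gt p))) // ler_nat.
apply: le_trans (canonical_density_moment H0 p_gt0 pn law_ge0) _.
rewrite lerD2l; under eq_bigr do rewrite lawE.
have C0 : 0 <= K * #|{: site y l}|%:R by rewrite mulr_ge0.
have := moment_le Q_semigroup QL C0
  (fun f => @moment_growth _ _ _ N_gt1 lN _ _ _ n f ddB) t0 cm_prob.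
(* The initial power sum is [#|H| ^- n.+1], which exactly cancels the normalisation of the
   density. *)
rewrite (sum_canonical_measureX H0) -ler_pdivrMr; last first.
  by rewrite invr_gt0 exprn_gt0 // card_hyperplane_gt0.
rewrite invrK mulrC => /le_trans; apply.
rewrite ler_expR -mulrA ler_wpM2l //.
(* The exponent is at most a constant times [N * N^(-4/3) = N^(-1/3)], and this power is at most
   1. *)
apply: (@le_trans _ _ (N%:R * (`|Ct| * N%:R `^ (- (4 / 3))))).
  rewrite ler_pM ?ler_nat ?card_site // (le_trans t_tau) //.
  rewrite (le_trans (ler_norm _)) // (le_trans (tauC _ (ltnW N_gt1))) //.
  by rewrite ler_wpM2r ?powR_ge0 // ler_norm.
rewrite mulrCA ler_piMr // -[X in X * _]powRr1 ?(ltW NR0) // -powRD; last first.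
  by rewrite (gt_eqF NR0) implybT.
by rewrite -[leRHS](powRr0 N%:R) ler_powR ?ler1n ?(ltnW N_gt1) //; lra.
Qed.
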